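(* Let $(\Omega,\mathcal{F},\mu)$ be a probability space. On the real Banach space $L^\infty(\Omega,\mu;\mathbb{R})$, $$\sigma_\infty(f)=\|f-\mathbb{E}f\|_\infty$$ is a strongly Leibniz seminorm.
   Context: $L^\infty(\Omega,\mu;\mathbb{R})$ is the real algebra of (classes of) real-valued essentially bounded measurable functions, with the essential supremum norm $\|\cdot\|_\infty$ and pointwise multiplication; $\mathbb{E}f=\int_\Omega f\,d\mu$, regarded as a constant function. A seminorm $L$ on a unital normed algebra $(\mathcal{A},\|\cdot\|)$ is called strongly Leibniz if (i) $L(1_\mathcal{A})=0$; (ii) $L(ab)\le\|a\|L(b)+\|b\|L(a)$ for all $a,b\in\mathcal{A}$; and (iii) $L(a^{-1})\le\|a^{-1}\|^2L(a)$ for every invertible $a\in\mathcal{A}$. *)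

(* Defs.v *)
From HB Require Import structures.
From mathcomp Require Import all_boot all_order all_algebra.
From mathcomp Require Import all_classical all_reals all_analysis.
From mathcomp Require Import measurable_realfun ess_sup_inf.

Set Implicit Arguments.
Unset Strict Implicit.
Unset Printing Implicit Defensive.

Import Order.TTheory GRing.Theory Num.Theory.

Local Open Scope classical_set_scope.
Local Open Scope ring_scope.

(* HB does not accept a structure inheriting from both [GRing.Algebra] and
   [Num.NormedZmodule] ([Num.NumDomain] is already their join in the
   hierarchy), hence this plain record. *)
Record normedAlgebra (K : numFieldType) := NormedAlgebra {
  normedAlgebra_sort :> algType K;
  alg_norm : normedAlgebra_sort -> K;
  alg_normD : forall a b, alg_norm (a + b) <= alg_norm a + alg_norm b;
  alg_normZ : forall (c : K) a, alg_norm (c *: a) = `|c| * alg_norm a;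
  alg_norm0_eq0 : forall a, alg_norm a = 0 -> a = 0;
  alg_normM : forall a b, alg_norm (a * b) <= alg_norm a * alg_norm b;
  alg_norm1 : alg_norm 1 = 1
}.

Record seminorm (K : numFieldType) (V : lmodType K) (L : V -> K) : Prop :=
  Seminorm {
  seminorm_ge0 : forall v, 0 <= L v;
  seminormD : forall u v, L (u + v) <= L u + L v;
  seminormZ : forall (c : K) v, L (c *: v) = `|c| * L v
}.

(* In [strongly_leibnizV], [b] is the inverse of the invertible element [a]
   (an [algType] has no inversion operator). *)
Record strongly_leibniz (K : numFieldType) (A : normedAlgebra K)
    (L : A -> K) : Prop := StronglyLeibniz {
  strongly_leibniz_seminorm : seminorm L;
  strongly_leibniz1 : L 1 = 0;
  strongly_leibnizM : forall a b : A,
    L (a * b) <= alg_norm a * L b + alg_norm b * L a;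
  strongly_leibnizV : forall a b : A,
    a * b = 1 -> b * a = 1 -> L b <= alg_norm b ^+ 2 * L a
}.
Arguments strongly_leibniz {K} A L.

(* An element of [LspaceType] is a class of measurable functions modulo almost
   everywhere equality; it coerces to a representative [T -> R]. *)
Definition Linfty d (T : measurableType d) (R : realType)
  (P : probability T R) : Type := LspaceType P (leey 1).

Section Linfty.
Context d (T : measurableType d) (R : realType) (P : probability T R).
Local Notation Linfty := (Linfty P).
Local Notation Lnormy f := (Lnorm P +oo%E (EFin \o f)).
Local Notation Q := (aeEqMfun (measurableTypeR R) P).
Implicit Types (u v w : Linfty) (f g : T -> R).

HB.instance Definition _ := gen_eqMixin Linfty.
HB.instance Definition _ := gen_choiceMixin Linfty.

Definition Linfty_repr u : T -> R := repr (LebesgueSpace.sort u).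

Definition Linfty_norm u : R := fine (Lnormy (Linfty_repr u)).

Local Notation rep := Linfty_repr.
Local Notation nm := Linfty_norm.

Let LnormyE f : Lnormy f = ess_sup P (abse \o (EFin \o f)).
Proof. by rewrite unlock /= probability_setT lte01. Qed.

Let eq_ae_Lnormy f g : f = g %[ae P] -> Lnormy f = Lnormy g.
Proof.
move=> fg; rewrite !LnormyE; apply: eq_ess_sup.
by apply: filterS fg => x /= /(_ I) ->.
Qed.

Let repr_pi_ae (f : {mfun T >-> measurableTypeR R}) :
  (repr (\pi_Q f)%qT : T -> R) = f %[ae P].
Proof.
by have /eqmodP/asboolP : (repr (\pi_Q f) = f %[mod Q])%qT by rewrite reprK.
Qed.

Fact finite_norm_pi (f : {mfun T >-> measurableTypeR R}) :
  finite_norm P +oo f -> finite_norm P +oo (repr (\pi_Q f)%qT : T -> R).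
Proof. by rewrite /finite_norm (eq_ae_Lnormy (repr_pi_ae f)). Qed.

Fact mfun_measurableTypeR f :
  measurable_fun setT f -> isMeasurableFun d _ T (measurableTypeR R) f.
Proof. by move=> mf; split. Qed.

Definition Linfty_class f (mf : measurable_fun setT f)
    (ff : finite_norm P +oo f) : Linfty :=
  let F := MeasurableFun.Pack (MeasurableFun.Class (mfun_measurableTypeR mf)) in
  LebesgueSpace.Pack (LebesgueSpace.Class
    (@isFinLebesgue.Axioms_ d T R P +oo%E (leey 1) _ (@finite_norm_pi F ff))).

Lemma Linfty_classK f mf ff : rep (@Linfty_class f mf ff) = f %[ae P].
Proof. exact: repr_pi_ae. Qed.

Lemma Linfty_eqP u v : rep u = rep v %[ae P] -> u = v.
Proof.
move=> uv.
have : LebesgueSpace.sort u = LebesgueSpace.sort v.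
  by rewrite -[LHS]reprK -[RHS]reprK; apply/eqmodP/asboolP.
case: u v {uv} => [u [[pu]]] [v [[pv]]] /= uv.
by case: v / uv pv => pv; rewrite (Prop_irrelevance pu pv).
Qed.

Lemma measurable_Linfty_repr u : measurable_fun setT (rep u).
Proof. exact: (@measurable_funPT _ _ T (measurableTypeR R)). Qed.

Let fin_rep u : finite_norm P +oo (rep u).
Proof. by case: u => u [[]]. Qed.

Let normE u : (nm u)%:E = Lnormy (rep u).
Proof.
rewrite /nm fineK// ge0_fin_numE ?Lnorm_ge0//; exact: fin_rep.
Qed.

Lemma Linfty_norm_ge0 u : 0 <= nm u.
Proof. by rewrite -lee_fin normE Lnorm_ge0. Qed.

Let Lnormy_le f (M : R) :
  (\forall x \ae P, `|f x| <= M) -> (Lnorm P +oo (EFin \o f) <= M%:E)%E.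
Proof. by move=> fM; rewrite LnormyE; apply/ess_supP; apply: filterS fM. Qed.

Lemma Linfty_norm_leP u (M : R) :
  (\forall x \ae P, `|rep u x| <= M) <-> nm u <= M.
Proof.
split=> [|uM]; first by move=> uM; rewrite -lee_fin normE; exact: Lnormy_le.
have : (Lnorm P +oo (EFin \o (rep u)) <= M%:E)%E by rewrite -normE lee_fin.
by rewrite LnormyE => /ess_supP; apply: filterS => x /=; rewrite lee_fin.
Qed.

Lemma Linfty_norm_ge u : \forall x \ae P, `|rep u x| <= nm u.
Proof. exact/Linfty_norm_leP. Qed.

Let fin_bound f (M : R) :
  (\forall x \ae P, `|f x| <= M) -> finite_norm P +oo f.
Proof. by move=> fM; apply: le_lt_trans (Lnormy_le fM) _; rewrite ltry. Qed.

Fact Linfty_cst_fin (c : R) : finite_norm P +oo (cst c : T -> R).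
Proof. by apply: (@fin_bound _ `|c|); exact: aeW. Qed.

Fact Linfty_opp_fin u : finite_norm P +oo (\- rep u).
Proof.
apply: (@fin_bound _ (nm u)); apply: filterS (Linfty_norm_ge u) => x /=.
by rewrite normrN.
Qed.

Fact Linfty_add_fin u v : finite_norm P +oo (rep u \+ rep v).
Proof.
apply: (@fin_bound _ (nm u + nm v)).
apply: filterS2 (Linfty_norm_ge u) (Linfty_norm_ge v) => x /= ux vx.
exact: le_trans (ler_normD _ _) (lerD ux vx).
Qed.

Fact Linfty_mul_fin u v : finite_norm P +oo (rep u \* rep v).
Proof.
apply: (@fin_bound _ (nm u * nm v)).
apply: filterS2 (Linfty_norm_ge u) (Linfty_norm_ge v) => x /= ux vx.
by rewrite normrM ler_pM.
Qed.

Fact Linfty_scale_fin c u : finite_norm P +oo (c \*: rep u).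
Proof.
apply: (@fin_bound _ (`|c| * nm u)).
apply: filterS (Linfty_norm_ge u) => x /= ux.
by rewrite /GRing.scale/= normrM ler_wpM2l.
Qed.

Definition Linfty_cst c : Linfty :=
  Linfty_class (measurable_cst c) (Linfty_cst_fin c).
Definition Linfty_opp u : Linfty :=
  Linfty_class (measurable_funN (measurable_Linfty_repr u)) (Linfty_opp_fin u).
Definition Linfty_add u v : Linfty :=
  Linfty_class
    (measurable_funD (measurable_Linfty_repr u) (measurable_Linfty_repr v))
    (Linfty_add_fin u v).
Definition Linfty_mul u v : Linfty :=
  Linfty_class
    (measurable_funM (measurable_Linfty_repr u) (measurable_Linfty_repr v))
    (Linfty_mul_fin u v).
Definition Linfty_scale c u : Linfty :=
  Linfty_class
    (measurable_funM (measurable_cst c) (measurable_Linfty_repr u))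
    (Linfty_scale_fin c u).


Let repE f mf ff : \forall x \ae P, rep (@Linfty_class f mf ff) x = f x.
Proof. by apply: filterS (Linfty_classK mf ff) => x; apply. Qed.

Let eqP' u v : (\forall x \ae P, rep u x = rep v x) -> u = v.
Proof. by move=> uv; apply: Linfty_eqP; apply: filterS uv => x ->. Qed.

Lemma Linfty_cstE c : \forall x \ae P, rep (Linfty_cst c) x = c.
Proof. exact: repE. Qed.
Lemma Linfty_oppE u : \forall x \ae P, rep (Linfty_opp u) x = - rep u x.
Proof. exact: repE. Qed.
Lemma Linfty_addE u v :
  \forall x \ae P, rep (Linfty_add u v) x = rep u x + rep v x.
Proof. exact: repE. Qed.
Lemma Linfty_mulE u v :
  \forall x \ae P, rep (Linfty_mul u v) x = rep u x * rep v x.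
Proof. exact: repE. Qed.
Lemma Linfty_scaleE c u :
  \forall x \ae P, rep (Linfty_scale c u) x = c * rep u x.
Proof. exact: repE. Qed.

Fact Linfty_addA : associative Linfty_add.
Proof.
move=> u v w; apply: eqP'; near=> x.
rewrite (near (Linfty_addE u (Linfty_add v w)) x)//.
rewrite (near (Linfty_addE v w) x)//.
rewrite (near (Linfty_addE (Linfty_add u v) w) x)//.
by rewrite (near (Linfty_addE u v) x)// addrA.
Unshelve. all: by end_near. Qed.

Fact Linfty_addC : commutative Linfty_add.
Proof.
move=> u v; apply: eqP'; near=> x.
by rewrite (near (Linfty_addE u v) x)// (near (Linfty_addE v u) x)// addrC.
Unshelve. all: by end_near. Qed.

Fact Linfty_add0 : left_id (Linfty_cst 0) Linfty_add.
Proof.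
move=> u; apply: eqP'; near=> x.
rewrite (near (Linfty_addE (Linfty_cst 0) u) x)//.
by rewrite (near (Linfty_cstE 0) x)// add0r.
Unshelve. all: by end_near. Qed.

Fact Linfty_addN : left_inverse (Linfty_cst 0) Linfty_opp Linfty_add.
Proof.
move=> u; apply: eqP'; near=> x.
rewrite (near (Linfty_addE (Linfty_opp u) u) x)//.
rewrite (near (Linfty_cstE 0) x)//.
by rewrite (near (Linfty_oppE u) x)// addNr.
Unshelve. all: by end_near. Qed.

HB.instance Definition _ := GRing.isZmodule.Build Linfty
  Linfty_addA Linfty_addC Linfty_add0 Linfty_addN.

Fact Linfty_mulA : associative Linfty_mul.
Proof.
move=> u v w; apply: eqP'; near=> x.
rewrite (near (Linfty_mulE u (Linfty_mul v w)) x)//.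
rewrite (near (Linfty_mulE v w) x)//.
rewrite (near (Linfty_mulE (Linfty_mul u v) w) x)//.
by rewrite (near (Linfty_mulE u v) x)// mulrA.
Unshelve. all: by end_near. Qed.

Fact Linfty_mulC : commutative Linfty_mul.
Proof.
move=> u v; apply: eqP'; near=> x.
by rewrite (near (Linfty_mulE u v) x)// (near (Linfty_mulE v u) x)// mulrC.
Unshelve. all: by end_near. Qed.

Fact Linfty_mul1 : left_id (Linfty_cst 1) Linfty_mul.
Proof.
move=> u; apply: eqP'; near=> x.
rewrite (near (Linfty_mulE (Linfty_cst 1) u) x)//.
by rewrite (near (Linfty_cstE 1) x)// mul1r.
Unshelve. all: by end_near. Qed.

Fact Linfty_mulDl : left_distributive Linfty_mul Linfty_add.
Proof.
move=> u v w; apply: eqP'; near=> x.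
rewrite (near (Linfty_mulE (Linfty_add u v) w) x)//.
rewrite (near (Linfty_addE u v) x)//.
rewrite (near (Linfty_addE (Linfty_mul u w) (Linfty_mul v w)) x)//.
rewrite (near (Linfty_mulE u w) x)//.
by rewrite (near (Linfty_mulE v w) x)// mulrDl.
Unshelve. all: by end_near. Qed.

Let norm_cst c : nm (Linfty_cst c) = `|c|.
Proof.
apply/eqP; rewrite eq_le; apply/andP; split.
  by apply/Linfty_norm_leP; apply: filterS (Linfty_cstE c) => x ->.
have PT : (0 < P setT)%E by rewrite probability_setT.
have ae_proper := ae_properfilter_algebraOfSetsType PT.
near (almost_everywhere P) => x.
rewrite -[in leLHS](near (Linfty_cstE c) x)//.
by near: x; exact: Linfty_norm_ge.
Unshelve. all: by end_near. Qed.

Fact Linfty_1_neq0 : Linfty_cst 1 != Linfty_cst 0.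
Proof.
apply/eqP => /(congr1 nm); rewrite !norm_cst normr1 normr0 => /eqP.
by rewrite oner_eq0.
Qed.

HB.instance Definition _ := GRing.Zmodule_isComNzRing.Build Linfty
  Linfty_mulA Linfty_mulC Linfty_mul1 Linfty_mulDl Linfty_1_neq0.

Fact Linfty_scaleA a b u :
  Linfty_scale a (Linfty_scale b u) = Linfty_scale (a * b) u.
Proof.
apply: eqP'; near=> x.
rewrite (near (Linfty_scaleE a (Linfty_scale b u)) x)//.
rewrite (near (Linfty_scaleE b u) x)//.
by rewrite (near (Linfty_scaleE (a * b) u) x)// mulrA.
Unshelve. all: by end_near. Qed.

Fact Linfty_scale1 : left_id 1 Linfty_scale.
Proof.
move=> u; apply: eqP'; near=> x.
by rewrite (near (Linfty_scaleE 1 u) x)// mul1r.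
Unshelve. all: by end_near. Qed.

Fact Linfty_scaleDr : right_distributive Linfty_scale +%R.
Proof.
move=> c u v; apply: eqP'; near=> x.
rewrite (near (Linfty_scaleE c (u + v)) x)//.
rewrite (near (Linfty_addE u v) x)//.
rewrite (near (Linfty_addE (Linfty_scale c u) (Linfty_scale c v)) x)//.
rewrite (near (Linfty_scaleE c u) x)//.
by rewrite (near (Linfty_scaleE c v) x)// mulrDr.
Unshelve. all: by end_near. Qed.

Fact Linfty_scaleDl u : {morph Linfty_scale^~ u : a b / a + b}.
Proof.
move=> a b; apply: eqP'; near=> x.
rewrite (near (Linfty_scaleE (a + b) u) x)//.
rewrite (near (Linfty_addE (Linfty_scale a u) (Linfty_scale b u)) x)//.
rewrite (near (Linfty_scaleE a u) x)//.
by rewrite (near (Linfty_scaleE b u) x)// mulrDl.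
Unshelve. all: by end_near. Qed.

HB.instance Definition _ := GRing.Zmodule_isLmodule.Build R Linfty
  Linfty_scaleA Linfty_scale1 Linfty_scaleDr Linfty_scaleDl.

Fact Linfty_scaleAl c u v : c *: (u * v) = c *: u * v.
Proof.
apply: eqP'; near=> x.
rewrite (near (Linfty_scaleE c (u * v)) x)//.
rewrite (near (Linfty_mulE u v) x)//.
rewrite (near (Linfty_mulE (c *: u) v) x)//.
by rewrite (near (Linfty_scaleE c u) x)// mulrA.
Unshelve. all: by end_near. Qed.

HB.instance Definition _ := GRing.Lmodule_isLalgebra.Build R Linfty
  Linfty_scaleAl.
HB.instance Definition _ := GRing.Lalgebra_isComAlgebra.Build R Linfty.

Fact Linfty_normD u v : nm (u + v) <= nm u + nm v.
Proof.
apply/Linfty_norm_leP; near=> x.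
rewrite (near (Linfty_addE u v) x)// (le_trans (ler_normD _ _))// lerD//.
  by near: x; exact: Linfty_norm_ge.
by near: x; exact: Linfty_norm_ge.
Unshelve. all: by end_near. Qed.

Fact Linfty_normM u v : nm (u * v) <= nm u * nm v.
Proof.
apply/Linfty_norm_leP; near=> x.
rewrite (near (Linfty_mulE u v) x)// normrM ler_pM//.
  by near: x; exact: Linfty_norm_ge.
by near: x; exact: Linfty_norm_ge.
Unshelve. all: by end_near. Qed.

Let normZ_le c u : nm (c *: u) <= `|c| * nm u.
Proof.
apply/Linfty_norm_leP; near=> x.
rewrite (near (Linfty_scaleE c u) x)// normrM ler_wpM2l//.
by near: x; exact: Linfty_norm_ge.
Unshelve. all: by end_near. Qed.

Fact Linfty_norm0_eq0 u : nm u = 0 -> u = 0.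
Proof.
move=> u0; apply: eqP'; near=> x.
rewrite (near (Linfty_cstE 0) x)//; apply/eqP; rewrite -normr_le0 -u0.
by near: x; exact: Linfty_norm_ge.
Unshelve. all: by end_near. Qed.

Fact Linfty_normZ c u : nm (c *: u) = `|c| * nm u.
Proof.
apply/eqP; rewrite eq_le normZ_le/=.
have [->|c0] := eqVneq c 0; first by rewrite normr0 mul0r Linfty_norm_ge0.
have := normZ_le c^-1 (c *: u).
rewrite scalerA mulVf// scale1r normfV ler_pdivlMl ?normr_gt0//.
Qed.

Fact Linfty_norm1 : nm 1 = 1.
Proof. by rewrite norm_cst normr1. Qed.

Definition Linfty_normedAlgebra : normedAlgebra R :=
  @NormedAlgebra R Linfty nm Linfty_normD Linfty_normZ Linfty_norm0_eq0
    Linfty_normM Linfty_norm1.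

Lemma Linfty_class_norm f mf ff : nm (@Linfty_class f mf ff) = fine (Lnormy f).
Proof. by rewrite /nm (eq_ae_Lnormy (Linfty_classK mf ff)). Qed.

Lemma Linfty_integrable u : P.-integrable setT (EFin \o rep u).
Proof.
have PT : P [set: T] \is a fin_num by rewrite probability_setT.
apply/Lfun1_integrable.
apply: (Lfun_subset (lexx 1%E) (leey 1) PT (leey 1)).
apply/andP; split; rewrite inE/=; first exact: measurable_Linfty_repr.
exact: fin_rep.
Qed.

(* The expectation of a class does not depend on the representative. *)
Lemma Linfty_class_expectation f mf ff :
  'E_P[rep (@Linfty_class f mf ff)]%E = 'E_P[f]%E.
Proof.
rewrite unlock; apply: ae_eq_integral => //.
- by apply/measurable_EFinP; exact: measurable_Linfty_repr.
- exact/measurable_EFinP.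
- by apply: filterS (Linfty_classK mf ff) => x /= + _ => /(_ I) ->.
Qed.

Definition sigma_infty (f : Linfty) : R :=
  nm (f - Linfty_cst (fine 'E_P[rep f])).

End Linfty.
Arguments sigma_infty {d T R} P f.

(* Main.v *)
Require Import Defs.
From mathcomp Require Import all_boot all_order all_algebra.
From mathcomp Require Import all_classical all_reals all_analysis.
From mathcomp Require Import measurable_realfun ring lra.

(** The seminorm axioms and [sigma 1 = 0] follow from the linearity of the
    expectation [E].  The two Leibniz inequalities rest on one estimate: for
    almost every [x],

      [E_y `|f x - f y| <= sigma f]        (1)

    (here [E_y] averages over [y]).  The triangle inequality alone would only
    give [2 * sigma f].  To gain the factor [2], put [s = sigma f] and let
    [w = f - E f], which has mean [0] and satisfies [`|w| <= s].  For a real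
    [c] with [`|c| <= s], the product [(s - c) * (s + w)] and its mirror image
    [(s + c) * (s - w)] are nonnegative, which says that
    [s * `|c - w| <= s ^+ 2 - c * w]: the convex function [w |-> `|c - w|] lies
    below its chord over the interval from [-s] to [s].  The right-hand side is
    affine in [w], so averaging replaces [w] by [0] and leaves [s ^+ 2]; it
    remains to divide by [s] ([mean0_increment_le]).

    Consequently, for every bounded [h] and almost every [x],
    [f x * E h - E (h * f) = E_y (h y * (f x - f y))] is at most [`|h| * sigma f]
    in absolute value ([sigma_infty_averaged_increment]).  The product rule then
    comes from

      [f x * g x - E (f * g) = f x * (g x - E g) + (f x * E g - E (g * f))]

    and the inverse rule, for [g = f^-1], from

      [g x - E g = - g x * (f x * E g - E (g * f))]

    because [g x * f x = 1] and [E (g * f) = 1]. *)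

Set Implicit Arguments.
Unset Strict Implicit.
Unset Printing Implicit Defensive.

Import Order.TTheory GRing.Theory Num.Theory.

Local Open Scope classical_set_scope.
Local Open Scope ring_scope.

(** The chord bound for [w |-> `|c - w|] over [-s, s], weighted by a factor [h]
    bounded by [M].  The slope of the chord is [- c / s]; multiplying by [s]
    avoids the division. *)
Lemma weighted_chord_le (R : realDomainType) (h M c w s : R) :
  `|h| <= M -> `|c| <= s -> `|w| <= s ->
  s * (h * (c - w)) <= M * (s ^+ 2 - c * w).
Proof.
move=> hM; rewrite !ler_norml => /andP[c1 c2] /andP[w1 w2].
have chord : `|s * (c - w)| <= s ^+ 2 - c * w.
  have p1 : 0 <= (s - c) * (s + w) by apply: mulr_ge0; lra.
  have p2 : 0 <= (s + c) * (s - w) by apply: mulr_ge0; lra.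
  by rewrite ler_norml; apply/andP; split; nra.
rewrite mulrCA (le_trans (ler_norm _))// normrM.
exact: ler_pM.
Qed.

Section mean.
Context d (T : measurableType d) (R : realType) (P : probability T R).
Local Notation Linfty := (Linfty P).
Local Notation rep := (@Linfty_repr d T R P).
Local Notation nm := (@Linfty_norm d T R P).
Local Notation cstc := (@Linfty_cst d T R P).
Implicit Types (u v w f g h : Linfty) (c : R).

Definition mean u : R := fine 'E_P[rep u]%E.

Let Lfun_rep u : rep u \in Lfun P 1.
Proof. exact/Lfun1_integrable/Linfty_integrable. Qed.

Lemma meanD u v : mean (u + v) = mean u + mean v.
Proof.
rewrite /mean [X in fine X]Linfty_class_expectation expectationD//.
by rewrite fineD// expectation_fin_num.
Qed.

Lemma meanZ c u : mean (c *: u) = c * mean u.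
Proof.
rewrite /mean [X in fine X]Linfty_class_expectation.
rewrite [X in 'E_P[X]%E](_ : _ = c \o* rep u); last first.
  by apply/funext => x; rewrite /= mulrC.
by rewrite expectationZl// fineM// expectation_fin_num.
Qed.

Lemma mean_cst c : mean (cstc c) = c.
Proof. by rewrite /mean Linfty_class_expectation expectation_cst. Qed.

Lemma meanN u : mean (- u) = - mean u.
Proof. by rewrite -scaleN1r meanZ mulN1r. Qed.

Lemma meanB u v : mean (u - v) = mean u - mean v.
Proof. by rewrite meanD meanN. Qed.

Lemma Linfty_subE u v : \forall x \ae P, rep (u - v) x = rep u x - rep v x.
Proof.
by apply: filterS2 (Linfty_addE u (- v)) (Linfty_oppE v) => x + vx; rewrite vx.
Qed.

Lemma mean_ge0 u : (\forall x \ae P, 0 <= rep u x) -> 0 <= mean u.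
Proof.
move=> u0; apply: fine_ge0.
suff -> : 'E_P[rep u]%E = 'E_P[(fun x => `|rep u x|)%R]%E by exact: expectation_ge0.
rewrite unlock; apply: ae_eq_integral => //.
- by apply/measurable_EFinP; exact: measurable_Linfty_repr.
- apply/measurable_EFinP; apply: measurableT_comp => //.
  exact: measurable_Linfty_repr.
- by apply: filterS u0 => x /= ux _; rewrite ger0_norm.
Qed.

Lemma le_mean u v : (\forall x \ae P, rep u x <= rep v x) -> mean u <= mean v.
Proof.
move=> uv; rewrite -subr_ge0 -meanB; apply: mean_ge0.
by apply: filterS2 uv (Linfty_subE v u) => x + ->; rewrite subr_ge0.
Qed.

Lemma Linfty_normN u : nm (- u) = nm u.
Proof. by rewrite -scaleN1r Linfty_normZ normrN1 mul1r. Qed.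

(** Constants as multiples of the unit make centering a combination of linear
    operations. *)
Lemma Linfty_cst_scale c : cstc c = c *: (1 : Linfty).
Proof.
apply: Linfty_eqP.
apply: filterS3 (Linfty_cstE P c) (Linfty_scaleE c 1) (Linfty_cstE P 1).
by move=> x -> + e _ => ->; rewrite e mulr1.
Qed.

Definition centered f : Linfty := f - cstc (mean f).

Lemma mean_centered f : mean (centered f) = 0.
Proof. by rewrite meanB mean_cst subrr. Qed.

Lemma centeredE f : \forall x \ae P, rep (centered f) x = rep f x - mean f.
Proof.
by apply: filterS2 (Linfty_subE f (cstc (mean f))) (Linfty_cstE P (mean f))
  => x -> ->.
Qed.

Lemma centeredD f g : centered (f + g) = centered f + centered g.
Proof. by rewrite /centered !Linfty_cst_scale meanD scalerDl opprD addrACA. Qed.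

Lemma centeredZ c f : centered (c *: f) = c *: centered f.
Proof. by rewrite /centered !Linfty_cst_scale meanZ scalerBr scalerA. Qed.

Lemma sigma_inftyE f : sigma_infty P f = nm (centered f).
Proof. by []. Qed.

Lemma sigma_infty_ge f :
  \forall x \ae P, `|rep f x - mean f| <= sigma_infty P f.
Proof.
by apply: filterS2 (centeredE f) (Linfty_norm_ge (centered f)) => x ->.
Qed.

Lemma sigma_infty_le f c :
  (\forall x \ae P, `|rep f x - mean f| <= c) -> sigma_infty P f <= c.
Proof.
move=> fc; rewrite sigma_inftyE; apply/Linfty_norm_leP.
by apply: filterS2 (centeredE f) fc => x ->.
Qed.

(** The expectation of the chord bound: its right-hand side is affine in [w], so
    that only the constant term survives when [w] has mean zero. *)
Lemma mean0_increment_le h w c : mean w = 0 -> `|c| <= nm w ->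
  c * mean h - mean (h * w) <= nm h * nm w.
Proof.
move=> w0 cw; set s := nm w.
have [s0|s0] := eqVneq s 0.
  (* here the chord bound is void, but [w] and [c] vanish *)
  have c0 : c = 0 by apply/eqP; rewrite -normr_le0 -s0.
  rewrite s0 mulr0 c0 (Linfty_norm0_eq0 s0) mulr0 mul0r sub0r.
  by rewrite -[X in mean X](scale0r (0 : Linfty)) meanZ mul0r oppr0.
have {s0}s0 : 0 < s by rewrite lt_neqAle eq_sym s0 Linfty_norm_ge0.
rewrite -(ler_pM2l s0).
have := @le_mean (s *: (c *: h - h * w)) (nm h *: (cstc (s ^+ 2) - c *: w)).
rewrite !meanZ !meanB !meanZ mean_cst w0 mulr0 subr0.
have -> : s * (nm h * s) = nm h * s ^+ 2 by ring.
apply; near=> x.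
rewrite (near (Linfty_scaleE s (c *: h - h * w)) x)//.
rewrite (near (Linfty_subE (c *: h) (h * w)) x)//.
rewrite (near (Linfty_scaleE c h) x)//.
rewrite (near (Linfty_mulE h w) x)//.
rewrite (near (Linfty_scaleE (nm h) (cstc (s ^+ 2) - c *: w)) x)//.
rewrite (near (Linfty_subE (cstc (s ^+ 2)) (c *: w)) x)//.
rewrite (near (Linfty_cstE P (s ^+ 2)) x)//.
rewrite (near (Linfty_scaleE c w) x)//.
rewrite (mulrC c) -mulrBr.
apply: weighted_chord_le => //.
- by near: x; exact: Linfty_norm_ge.
- by near: x; exact: Linfty_norm_ge.
Unshelve. all: by end_near. Qed.

Lemma normr_mean0_increment_le h w c : mean w = 0 -> `|c| <= nm w ->
  `|c * mean h - mean (h * w)| <= nm h * nm w.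
Proof.
move=> w0 cw; rewrite ler_norml lerNl mean0_increment_le// andbT.
have := mean0_increment_le (- h) w0 cw.
by rewrite Linfty_normN mulNr !meanN mulrN -opprD.
Qed.

(** The left-hand side is the average over [y] of [h y * (f x - f y)], so this is
    estimate (1) of the introduction tested against [h]. *)
Lemma sigma_infty_averaged_increment h f :
  \forall x \ae P, `|rep f x * mean h - mean (h * f)| <= nm h * sigma_infty P f.
Proof.
apply: filterS (sigma_infty_ge f) => x fx.
have := normr_mean0_increment_le h (mean_centered f) fx.
suff -> : mean (h * centered f) = mean (h * f) - mean f * mean h.
  by rewrite opprB addrA mulrBl subrK.
by rewrite mulrBr meanB Linfty_cst_scale -scalerAr mulr1 meanZ.
Qed.

Lemma seminorm_sigma_infty : seminorm (sigma_infty P).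
Proof.
split=> [f|f g|c f]; rewrite !sigma_inftyE.
- exact: Linfty_norm_ge0.
- by rewrite centeredD Linfty_normD.
- by rewrite centeredZ Linfty_normZ.
Qed.

Lemma sigma_infty1 : sigma_infty P 1 = 0.
Proof.
by rewrite sigma_inftyE /centered mean_cst subrr
  -(scale0r (0 : Linfty)) Linfty_normZ normr0 mul0r.
Qed.

Lemma sigma_inftyM f g :
  sigma_infty P (f * g) <= nm f * sigma_infty P g + nm g * sigma_infty P f.
Proof.
apply: sigma_infty_le; near=> x.
rewrite (near (Linfty_mulE f g) x)//.
rewrite (_ : _ - _ = rep f x * (rep g x - mean g)
  + (rep f x * mean g - mean (g * f))); last by rewrite (mulrC g f); ring.
rewrite (le_trans (ler_normD _ _))// lerD//.
- rewrite normrM ler_pM//.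
  + by near: x; exact: Linfty_norm_ge.
  + by near: x; exact: sigma_infty_ge.
- by near: x; exact: sigma_infty_averaged_increment.
Unshelve. all: by end_near. Qed.

Lemma sigma_inftyV f g :
  f * g = 1 -> sigma_infty P g <= nm g ^+ 2 * sigma_infty P f.
Proof.
move=> fg1; have gf1 : g * f = 1 by rewrite mulrC.
apply: sigma_infty_le; near=> x.
have gfx : rep g x * rep f x = 1.
  rewrite -(near (Linfty_mulE g f) x)// -[Linfty_mul g f]/(g * f) gf1.
  by near: x; exact: Linfty_cstE.
rewrite (_ : _ - _ = - (rep g x * (rep f x * mean g - mean (g * f)))).
  rewrite normrN normrM expr2 -mulrA ler_pM//.
  + by near: x; exact: Linfty_norm_ge.
  + by near: x; exact: sigma_infty_averaged_increment.
by rewrite mulrBr mulrA gfx gf1 mean_cst; ring.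
Unshelve. all: by end_near. Qed.

End mean.

Theorem theorem2p6 (d : measure_display) (T : measurableType d) (R : realType)
    (P : probability T R) :
  strongly_leibniz (Linfty_normedAlgebra P) (sigma_infty P).
Proof.
split.
- exact: seminorm_sigma_infty.
- exact: sigma_infty1.
- exact: sigma_inftyM.
- by move=> f g fg1 _; exact: sigma_inftyV.
Qed.
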